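(* Let $G=(V,E,w)$ be a weighted planar graph (fixed planar embedding, positive edge weights), let $d,\delta'>0$, and let $S=(s_1,\dots,s_\ell)$ be a sequence of vertices on a common face arranged in cyclic order. Let $M$ be the set of all multiples of $\delta'/\ell$ in the interval $[-\lceil \ell d/\delta'\rceil\,\delta'/\ell,\ \lceil \ell d/\delta'\rceil\,\delta'/\ell]$. For $i\in[\ell-1]$ and $\Delta\in M$ let $A_i^\Delta=\{v\in V: d(v,s_i)\le d(v,s_{i+1})+\Delta\}$, let $X=[\ell]\times M$, and let $\mathcal F=\{\{(i,\Delta): v\in A_i^\Delta\}: v\in V\}\subseteq 2^X$. Then $\mathcal F$ has VC dimension at most $3$ on universe $X$.
   Context: $d(\cdot,\cdot)$ is the weighted shortest-path distance. A family $\mathcal F$ of subsets of $X$ has VC dimension $k$ if $k$ is the largest size of $Y\subseteq X$ such that for every $Y'\subseteq Y$ there is $F\in\mathcal F$ with $Y\cap F=Y'$. *)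

(* Defs.v *)
From mathcomp Require Import all_boot all_order all_algebra.
From mathcomp Require Import all_classical all_reals ereal.

Set Implicit Arguments.
Unset Strict Implicit.
Unset Printing Implicit Defensive.

Import Order.TTheory GRing.Theory Num.Theory.

Local Open Scope classical_set_scope.
Local Open Scope ring_scope.

(* A planar embedding is given combinatorially, by a rotation system of genus *)
(* zero.  Each undirected edge consists of two opposite darts, exchanged by   *)
(* [rev_dart]; [next_dart x] is the dart that follows [x] in the cyclic order *)
(* of the darts leaving [source x].  After traversing [x] from its source to  *)
(* its target, the boundary walk of a face continues with                     *)
(* [next_dart (rev_dart x)], so the faces are the orbits of the composite.    *)
Section RotationSystem.
Variables (D : finType) (rev_dart next_dart : D -> D).

Definition next_on_face (x : D) : D := next_dart (rev_dart x).

Definition dart_link : rel D :=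
  [rel x y | (rev_dart x == y) || (next_dart x == y)].

(* Euler's formula summed over the c connected components that contain a      *)
(* dart: V + F = E + 2c.  As every component satisfies V - E + F <= 2, this   *)
(* says that each of them is embedded in the sphere.                          *)
Definition genus_zero : Prop :=
  (fcard next_dart D + fcard next_on_face D
   = fcard rev_dart D + (n_comp dart_link D).*2)%N.

End RotationSystem.

(* Loops, parallel edges, isolated vertices and disconnected graphs are       *)
(* allowed.                                                                   *)
Record weighted_plane_graph (R : realType) := WeightedPlaneGraph {
  vertex : finType;
  dart : finType;
  source : dart -> vertex;
  rev_dart : dart -> dart;
  next_dart : dart -> dart;
  weight : dart -> R;
  rev_dart_inv : involutive rev_dart;
  rev_dart_neq : forall x, rev_dart x != x;
  next_dart_inj : injective next_dart;
  source_next_dart : forall x y,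
    (source x == source y) = fconnect next_dart x y;
  weight_rev : forall x, weight (rev_dart x) = weight x;
  weight_gt0 : forall x, 0 < weight x;
  planar : genus_zero rev_dart next_dart
}.

Section PlaneGraph.
Variables (R : realType) (G : weighted_plane_graph R).
Local Notation V := (vertex G).
Local Notation D := (dart G).

Definition target (x : D) : V := source (rev_dart x).

Fixpoint walk (u : V) (p : seq D) (v : V) : bool :=
  if p is x :: p' then (source x == u) && walk (target x) p' v else u == v.

Definition walk_length (p : seq D) : R := \sum_(x <- p) weight x.

(* The distance between vertices of distinct components is [+oo].             *)
Definition wdist (u v : V) : \bar R :=
  ereal_inf [set (walk_length p)%:E | p in [set p | walk u p v]].

(* The sequence of vertices met by one turn around a face, from an arbitrary  *)
(* starting point.  A vertex occurs once for each of its corners in the face. *)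
(* An isolated vertex has no dart and is a boundary walk by itself.           *)
Definition facial_walk (b : seq V) : Prop :=
  (exists x : D,
     b = [seq source y |
            y <- orbit (next_on_face (@rev_dart R G) (@next_dart R G)) x])
  \/ (exists v : V, (forall x : D, source x != v) /\ b = [:: v]).

(* Both orientations of the face are allowed.                                 *)
Definition cyclic_on_face (s : seq V) : Prop :=
  exists b, facial_walk b /\ (subseq s b \/ subseq s (rev b)).

(* The multiples of delta / l in [- m, m], m = ceil (l d / delta) delta / l.  *)
Definition offsets (l : nat) (d delta : R) : set R :=
  let step := delta / l%:R in
  let m := (Num.ceil (l%:R * d / delta))%:~R * step in
  [set x | (exists k : int, x = k%:~R * step) /\ - m <= x <= m].

(* Indices start at 0: s_1, ..., s_l are [nth _ s 0], ..., [nth _ s l.-1].    *)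
(* The default value of [nth] is irrelevant for i.+1 < size s.                *)
Definition halfspace (s : seq V) (i : nat) (x : R) : set V :=
  [set v | (wdist v (nth v s i) <= wdist v (nth v s i.+1) + x%:E)%E].

Definition pair_universe (s : seq V) (d delta : R) : set (nat * R) :=
  `I_(size s) `*` offsets (size s) d delta.

(* The set [halfspace s i x] exists only for the first (size s).-1 indices,   *)
(* so no member of the family contains a pair whose index is the last one.    *)
Definition trace_set (s : seq V) (d delta : R) (v : V) : set (nat * R) :=
  [set p | [/\ (p.1 < (size s).-1)%N, offsets (size s) d delta p.2
             & halfspace s p.1 p.2 v]].

Definition trace_family (s : seq V) (d delta : R) : set (set (nat * R)) :=
  [set trace_set s d delta v | v in [set: V]].

End PlaneGraph.

Definition shattered (T : Type) (F : set (set T)) (Y : set T) : Prop :=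
  forall Y' : set T, Y' `<=` Y -> exists2 A, F A & Y `&` A = Y'.

Definition has_VC_dim (T : Type) (X : set T) (F : set (set T)) (k : nat) :
    Prop :=
  (exists Y, [/\ Y `<=` X, shattered F Y & (Y #= `I_k)%card])
  /\ (forall Y, Y `<=` X -> shattered F Y -> (Y #<= `I_k)%card).

(* Main.v *)
Require Import Defs.
From mathcomp Require Import all_boot all_order all_algebra.
From mathcomp Require Import all_classical all_reals ereal.
From mathcomp Require Import zify lra.

(* Sets [A_i^x] with the same [i] are nested, so four shattered pairs have     *)
(* distinct indices i1 < i2 < i3 < i4.  Take v with trace {1, 3} and u with    *)
(* trace {2, 4}.  Geodesics from v to P1, ..., P4 = s_i1, s_(i2+1), s_i3,      *)
(* s_(i4+1) and from u to Q1, ..., Q4 = s_(i1+1), s_i2, s_(i3+1), s_i4 are     *)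
(* such that v-Pk and u-Qk are disjoint, by rerouting.  Write (j,k) if some    *)
(* v-Pj and u-Qk geodesics meet.  Along the face the order is                  *)
(* P1 Q1 Q2 P2 P3 Q3 Q4 P4, and walks joining alternating pairs meet.  Hence   *)
(* (1,3) or (3,1) holds, and (2,4) or (4,2).  A walk Pj-Qk through a common    *)
(* vertex separates other terminals, which gives (1,3) => (1,4), (4,3);        *)
(* (2,4) => (2,3), (3,4); (3,1) => (3,2), (2,1); (4,2) => (4,1), (1,2).  But   *)
(* (j,k) and (k,j) exclude each other for {j,k} = 12, 23, 34, 14.              *)
(* That alternating walks meet follows from Euler's formula: a dimension count *)
(* over F_2 shows that every cycle bounds a set of faces.                      *)

Set Implicit Arguments.
Unset Strict Implicit.
Unset Printing Implicit Defensive.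

Import Order.TTheory GRing.Theory Num.Theory.

Local Open Scope classical_set_scope.
Local Open Scope ring_scope.

(** The argument has a planar half and a metric half. The planar half is [face_crossing]: walks
    whose ends alternate along a face share a vertex. It follows from [cycle_bounds], the vanishing
    of the first homology over F_2, because a closed-up walk then has two sides ([side_of_walk]) and
    a walk avoiding it stays on one of them.

    The metric half is exchange: two geodesics may swap their tails at a common vertex. Swapping
    ends shows that v in and u out of the same halfspace have disjoint geodesics to its two
    terminals ([halfspace_not_meet]). Together with crossings, exchange yields the three rules of
    the case analysis in [halfspace_alternation]: [meet_of_crossing] produces a meeting pair,
    [meet_forced] propagates it, [meet_exclusive] forbids two opposite ones. The relation [meet]
    ranges over all geodesics, so ties need no choice. Neighbouring terminals may coincide, hence
    the weak inequalities between positions. *)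

(** * Functions constant on the classes of a relation, over F_2 *)

Section ConnectMatrix.
Variables (D : finType) (r : rel D).
Hypothesis r_sym : connect_sym r.
Local Notation F := 'F_2.
Local Notation N := #|D|.
Local Notation root := fingraph.root.

Definition fun_row (f : D -> F) : 'rV[F]_N := \row_j f (enum_val j).

Definition connect_mx : 'M[F]_N :=
  \matrix_(i, j) (connect r (enum_val i) (enum_val j))%:R.

Lemma fun_rowE (v : 'rV[F]_N) : v = fun_row (fun x => v 0 (enum_rank x)).
Proof. by apply/rowP=> j; rewrite mxE enum_valK. Qed.

Lemma sum_enum_val (G : D -> F) : \sum_(j < N) G (enum_val j) = \sum_x G x.
Proof. by rewrite (reindex _ (onW_bij _ (@enum_val_bij D))). Qed.

Lemma sum_delta (G : D -> F) y : \sum_x G x * (x == y)%:R = G y.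
Proof.
rewrite (bigD1 y) //= eqxx mulr1 big1 ?addr0 // => x /negPf ->.
by rewrite mulr0.
Qed.

Lemma fun_row_connect_mxP (f : D -> F) :
  reflect (forall x y, r x y -> f x = f y) (fun_row f <= connect_mx)%MS.
Proof.
apply: (iffP submxP) => [[w Ew] x y rxy | f_inv].
  have fE z : f z = \sum_t w 0 (enum_rank t) * (connect r t z)%:R.
    have -> : f z = fun_row f 0 (enum_rank z) by rewrite mxE enum_rankK.
    rewrite Ew mxE -sum_enum_val; apply: eq_bigr => j _.
    by rewrite mxE enum_valK enum_rankK.
  rewrite !fE; apply: eq_bigr => t _; congr (_ * (_ : bool)%:R).
  by rewrite ![connect r t _]r_sym (same_connect r_sym (connect1 rxy)).
have f_root x : f (root r x) = f x.
  have /connectP[p] := connect_root r x; move: (root r x) => y.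
  elim: p x => [|z p IHp] x /= => [_ -> // | /andP[rxz rzp] Ey].
  by rewrite (IHp z) // (f_inv _ _ rxz).
(* Coefficients sit on the class representatives only, so each class indicator is used once. *)
exists (fun_row (fun x => f x * (root r x == x)%:R)).
apply/rowP=> j; rewrite !mxE.
rewrite (eq_bigr (fun i => (f (enum_val i) * (enum_val i == root r (enum_val j))%:R))) => [|i _].
  by rewrite (sum_enum_val (fun x => f x * (x == _)%:R)) sum_delta f_root.
rewrite !mxE -mulrA -natrM mulnb; congr (_ * (_ : bool)%:R).
rewrite -(root_connect r_sym).
have [-> | ne] := eqVneq (enum_val i) (root r (enum_val j)).
  by rewrite (root_root r_sym) !eqxx.
by apply/andP=> -[/eqP-> /eqP E]; rewrite E eqxx in ne.
Qed.

(** The matrix factors as [S *m S^T] through the set of class representatives, and [C], which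
    selects the representatives, gives [S] a left inverse. *)
Lemma rank_connect_mx : \rank connect_mx = n_comp r D.
Proof.
set k := n_comp r D; pose A := [pred x | roots r x].
have kE : #|A| = k by apply: eq_card => x; rewrite !inE andbT.
pose S := \matrix_(i < N, j < #|A|) (root r (enum_val i) == enum_val j)%:R : 'M[F]_(N, #|A|).
pose C := \matrix_(i < N, j < #|A|) (enum_val i == enum_val j)%:R : 'M[F]_(N, #|A|).
have rootA (j : 'I_#|A|) : root r (enum_val j) = enum_val j.
  by apply/eqP; have := enum_valP j; rewrite inE.
have ME : connect_mx = S *m S^T.
  apply/matrixP=> i j; rewrite !mxE -(root_connect r_sym).
  have rA : root r (enum_val j) \in A by rewrite inE roots_root.
  rewrite (bigD1 (enum_rank_in rA (root r (enum_val j)))) //= !mxE enum_rankK_in //.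
  rewrite eqxx mulr1 big1 ?addr0 // => l /eqP nel.
  rewrite !mxE -natrM mulnb; case: eqP => //= _; case: eqP => // E.
  by case: nel; apply: enum_val_inj; rewrite enum_rankK_in.
have CS : C^T *m S = 1%:M.
  apply/matrixP=> i j; rewrite !mxE.
  under eq_bigr => l _ do rewrite !mxE mulrC.
  rewrite (sum_enum_val (fun x => (root r x == enum_val j)%:R * (x == enum_val i)%:R)).
  by rewrite (sum_delta (fun x => (root r x == enum_val j)%:R)) rootA (inj_eq enum_val_inj).
apply/eqP; rewrite eqn_leq; apply/andP; split.
  by rewrite ME -kE (leq_trans (mxrankM_maxl _ _)) ?rank_leq_col.
have <- : \rank (C^T *m connect_mx *m C) = k.
  by rewrite ME mulmxA CS mul1mx -[C]trmxK -trmx_mul CS trmx1 mxrank1.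
by rewrite (leq_trans (mxrankM_maxl _ _)) ?mxrankM_maxr.
Qed.

End ConnectMatrix.

Lemma addrrF2 (a : 'F_2) : a + a = 0.
Proof. by rewrite addrr_pchar2 // pchar_Fp. Qed.

Lemma addF2_eq0 (a b : 'F_2) : a + b = 0 -> a = b.
Proof. by move=> /eqP; rewrite addr_eq0 => /eqP->; rewrite oppr_pchar2 // pchar_Fp. Qed.

Lemma capmx_connect_mx (D : finType) (r1 r2 r : rel D) :
    connect_sym r1 -> connect_sym r2 -> connect_sym r ->
    (forall f : D -> 'F_2, (forall x y, r x y -> f x = f y) <->
       (forall x y, r1 x y -> f x = f y) /\ (forall x y, r2 x y -> f x = f y)) ->
  (connect_mx r1 :&: connect_mx r2 :=: connect_mx r)%MS.
Proof.
move=> sym1 sym2 sym invE; apply/eqmxP/andP; split; apply/rV_subP=> v.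
  rewrite sub_capmx (fun_rowE v) => /andP[/(fun_row_connect_mxP sym1) h1].
  by move/(fun_row_connect_mxP sym2)=> h2; apply/(fun_row_connect_mxP sym)/invE.
rewrite sub_capmx (fun_rowE v) => /(fun_row_connect_mxP sym)/invE[h1 h2].
by apply/andP; split; apply/fun_row_connect_mxP.
Qed.

(** * Homology of a genus-zero rotation system *)

Section Homology.
Variables (D : finType) (rev next : D -> D).
Hypotheses (revK : involutive rev) (rev_neq : forall x, rev x != x).
Hypothesis next_inj : injective next.
Hypothesis planar_map : genus_zero rev next.
Local Notation F := 'F_2.
Local Notation N := #|D|.
Local Notation face := (next_on_face rev next).

Lemma next_on_face_inj : injective face.
Proof. exact: inj_comp next_inj (can_inj revK). Qed.

Lemma dart_link_sym : connect_sym (dart_link rev next).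
Proof.
have sub x y : dart_link rev next x y -> connect (dart_link rev next) y x.
  case/orP=> /eqP <-; first by apply/connect1/orP; left; rewrite revK.
  have : fconnect next (next x) x by rewrite fconnect_sym ?fconnect1.
  apply: connect_sub => a b /eqP <-.
  by apply/connect1/orP; right.
have subc x y : connect (dart_link rev next) x y -> connect (dart_link rev next) y x.
  case/connectP=> p; elim: p x => [|z p IHp] x /= => [_ -> // | /andP[xz zp] Ey].
  exact: connect_trans (IHp _ zp Ey) (sub _ _ xz).
by move=> x y; apply/idP/idP; apply: subc.
Qed.

Lemma card_dart : #|D| = (fcard rev D).*2.
Proof.
rewrite -muln2 (fcard_order_set (can_inj revK)) //.
apply/fintype.subsetP=> x _; rewrite inE; apply/eqP.
have -> : 2%N = #|pred2 x (rev x)| by rewrite card2 eq_sym rev_neq.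
apply: eq_card => y; rewrite !inE; apply/idP/idP.
  case/iter_findex; move: (findex _ _ _) => n; elim: n y => [|n IHn] y /= <-.
    by rewrite eqxx.
  by case/orP: (IHn _ erefl) => /eqP->; rewrite ?revK eqxx ?orbT.
by case/orP=> /eqP->; rewrite ?connect0 ?fconnect1.
Qed.

(** A function [f] on darts encodes the edge chain [f x + f (rev x)]. This matrix computes that
    chain, so its kernel is the set of encodings of zero. *)
Definition rev_sum_mx : 'M[F]_N :=
  \matrix_(i, j) ((enum_val i == enum_val j)%:R
                  + (enum_val i == rev (enum_val j))%:R).

Lemma fun_row_rev_sum (f : D -> F) :
  fun_row f *m rev_sum_mx = fun_row (fun x => f x + f (rev x)).
Proof.
apply/rowP=> j; rewrite !mxE.
under eq_bigr => i _ do rewrite !mxE mulrDr.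
rewrite big_split /=.
rewrite (sum_enum_val (fun x => f x * (x == enum_val j)%:R)) sum_delta.
by rewrite (sum_enum_val (fun x => f x * (x == rev (enum_val j))%:R)) sum_delta.
Qed.

Lemma tr_rev_sum_mx : rev_sum_mx^T = rev_sum_mx.
Proof.
apply/matrixP=> i j; rewrite !mxE eq_sym; congr (_ + (_ : bool)%:R).
by rewrite eq_sym (can2_eq revK revK).
Qed.

Lemma fun_row_connect (r : rel D) (f : D -> F) :
    connect_sym r ->
  fun_row f *m connect_mx r = fun_row (fun z => \sum_(x | connect r z x) f x).
Proof.
move=> r_sym; apply/rowP=> j; rewrite !mxE.
under eq_bigr => i _ do rewrite !mxE.
rewrite (sum_enum_val (fun x => f x * (connect r x (enum_val j))%:R)).
rewrite [RHS]big_mkcond; apply: eq_bigr => x _.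
by rewrite r_sym; case: ifP => _; rewrite ?mulr1 ?mulr0.
Qed.

Lemma tr_connect_mx (r : rel D) : connect_sym r -> (connect_mx r)^T = connect_mx r.
Proof. by move=> r_sym; apply/matrixP=> i j; rewrite !mxE r_sym. Qed.

Lemma ker_rev_sum : (kermx rev_sum_mx :=: connect_mx (frel rev))%MS.
Proof.
have sym := fconnect_sym (can_inj revK).
apply/eqmxP/andP; split; apply/rV_subP=> v; rewrite (fun_rowE v); move: (fun x => _) => f.
  move/sub_kermxP; rewrite fun_row_rev_sum => /rowP f0.
  apply/(fun_row_connect_mxP sym) => x y /eqP <-.
  by have := f0 (enum_rank x); rewrite !mxE enum_rankK => /addF2_eq0.
move/(fun_row_connect_mxP sym) => f_inv; apply/sub_kermxP.
rewrite fun_row_rev_sum; apply/rowP=> j; rewrite !mxE.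
by rewrite -(f_inv (enum_val j) (rev (enum_val j))) ?addrrF2 //=.
Qed.

(* The first homology of the sphere with coefficients in F_2 vanishes: a       *)
(* chain without boundary (even degree at every vertex) bounds a set of faces. *)
Theorem cycle_bounds (y : D -> F) :
    (forall z, \sum_(x | fconnect next z x) (y x + y (rev x)) = 0) ->
  exists2 g : D -> F, (forall x, g (face x) = g x)
    & (forall x, g x + g (rev x) = y x + y (rev x)).
Proof.
move=> y_cycle.
have symN := fconnect_sym next_inj.
have symE := fconnect_sym (can_inj revK).
have symF := fconnect_sym next_on_face_inj.
have symL := dart_link_sym.
set ON := connect_mx (frel next); set OE := connect_mx (frel rev).
set OF := connect_mx (frel face); set T := rev_sum_mx.
set OL := connect_mx (dart_link rev next).
have capNE : (ON :&: OE :=: OL)%MS.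
  apply: capmx_connect_mx => // f; split=> [h | [hN hE] a b].
    by split=> a b /= ab; apply: h; rewrite /dart_link /= ab ?orbT.
  by case/orP=> ab; [apply: hE | apply: hN].
have capFE : (OF :&: OE :=: OL)%MS.
  apply: capmx_connect_mx => // f; split=> [h | [hF hE] a b].
    split=> a b /= /eqP <-; last by apply: h; rewrite /dart_link /= eqxx.
    have -> : f a = f (rev a) by apply: h; rewrite /dart_link /= eqxx.
    by apply: h; rewrite /dart_link /= eqxx orbT.
  case/orP=> /eqP <-; first by apply: hE => /=.
  have -> : f a = f (rev a) by apply: hE => /=.
  by apply: hF; rewrite /= /next_on_face revK.
(* [T *m ON] is the boundary map from chains to vertices. Its transpose is [ON *m T], of rank V - c,
   since [ON] meets the kernel of [T] in the functions constant on components. *)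
have rank_cut : (\rank (T *m ON) + n_comp (dart_link rev next) D = fcard next D)%N.
  rewrite -mxrank_tr trmx_mul tr_rev_sum_mx tr_connect_mx //.
  rewrite -[RHS]rank_connect_mx // -(mxrank_mul_ker ON T) -rank_connect_mx //.
  congr (_ + _)%N.
  by rewrite -capNE (cap_eqmx (eqmx_refl ON) ker_rev_sum).
have rank_sum : (\rank (OF + OE)%MS + n_comp (dart_link rev next) D
                 = fcard face D + fcard rev D)%N.
  rewrite -(rank_connect_mx symL) -(rank_connect_mx symF) -(rank_connect_mx symE).
  by rewrite -(mxrank_sum_cap OF OE) capFE.
(* A set of faces has no boundary: for a face-invariant [g], the values [g (rev x)] over the darts
   at a vertex are the values of [g] at the same darts, permuted by [next]. *)
have sub_ker : (OF + OE <= kermx (T *m ON))%MS.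
  rewrite addsmx_sub; apply/andP; split; apply/rV_subP=> v; rewrite (fun_rowE v); move: (fun x => _) => g.
    move/(fun_row_connect_mxP symF) => g_inv; apply/sub_kermxP.
    rewrite mulmxA fun_row_rev_sum fun_row_connect //; apply/rowP=> j; rewrite !mxE.
    rewrite big_split /=.
    set z := enum_val j.
    rewrite [X in _ + X](reindex_inj (can_inj revK)) /=.
    under [X in _ + X]eq_bigr => x _ do
      rewrite revK (g_inv x (face x) (eqxx _)).
    rewrite [X in _ + X](eq_bigl (fun x => fconnect next z (face x))); last first.
      by move=> x; rewrite -(same_fconnect1_r next_inj).
    by rewrite -(@reindex_inj _ _ _ _ face (fconnect next z) g next_on_face_inj) addrrF2.
  move/(fun_row_connect_mxP symE) => h_inv; apply/sub_kermxP.
  rewrite mulmxA fun_row_rev_sum; apply/eqP; rewrite (_ : fun_row _ = 0) ?mul0mx //.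
  by apply/rowP=> j; rewrite !mxE -(h_inv (enum_val j) (rev (enum_val j))) ?addrrF2 //=.
(* Equality of dimensions, 2E - (V - c) = F + E - c, is Euler's formula. *)
have ker_sub : (kermx (T *m ON) <= OF + OE)%MS.
  rewrite -(mxrank_leqif_sup sub_ker) mxrank_ker.
  move: card_dart planar_map rank_cut rank_sum; rewrite /genus_zero; lia.
have : (fun_row y <= OF + OE)%MS.
  apply: submx_trans ker_sub; apply/sub_kermxP.
  rewrite mulmxA fun_row_rev_sum fun_row_connect //; apply/rowP=> j.
  by rewrite !mxE y_cycle.
case/sub_addsmxP=> -[a b] /= /rowP yE.
have /(fun_row_connect_mxP symF) gF : (fun_row (fun x => (a *m OF) 0 (enum_rank x)) <= OF)%MS.
  by rewrite -fun_rowE submxMl.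
have /(fun_row_connect_mxP symE) hE : (fun_row (fun x => (b *m OE) 0 (enum_rank x)) <= OE)%MS.
  by rewrite -fun_rowE submxMl.
have {}yE x : y x = (a *m OF) 0 (enum_rank x) + (b *m OE) 0 (enum_rank x).
  by have := yE (enum_rank x); rewrite !mxE enum_rankK.
exists (fun x => (a *m OF) 0 (enum_rank x)) => x.
  by rewrite -(gF x (face x)) //=.
rewrite !yE -(hE x (rev x)) //= addrACA addrrF2 addr0 //.
Qed.

End Homology.

(** * Walks, and crossings along a face *)

Section Walks.
Variables (R : realType) (G : weighted_plane_graph R).
Local Notation V := (vertex G).
Local Notation D := (dart G).
Local Notation face := (next_on_face (@rev_dart R G) (@next_dart R G)).
Implicit Types (u v w z : V) (p q : seq D).

Definition visits u p : seq V := u :: [seq target x | x <- p].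

Lemma walk_cat u v w p q : walk u p v -> walk v q w -> walk u (p ++ q) w.
Proof.
elim: p u => [|x p IHp] u /= => [/eqP-> // | /andP[-> /IHp]].
by move=> h /h ->.
Qed.

Lemma walk_length_cat p q : walk_length (p ++ q) = walk_length p + walk_length q.
Proof. by rewrite /walk_length big_cat. Qed.

Lemma walk_length_ge0 p : 0 <= walk_length p.
Proof. by apply: sumr_ge0 => x _; apply/ltW/weight_gt0. Qed.

Lemma walk_split u v z p : walk u p v -> z \in visits u p ->
  exists p1 p2, [/\ p = p1 ++ p2, walk u p1 z & walk z p2 v].
Proof.
elim: p u => [|x p IHp] u /=.
  move=> uv; rewrite inE => /eqP->.
  by exists [::], [::]; split=> //=.
case/andP=> xu xp; rewrite inE => /orP[/eqP-> | zp].
  by exists [::], (x :: p); split=> //=; rewrite xu.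
have [p1 [p2 [-> h1 h2]]] := IHp _ xp zp.
by exists (x :: p1), p2; split=> //=; rewrite xu.
Qed.

Lemma visits_last u v p : walk u p v -> v \in visits u p.
Proof.
elim: p u => [|x p IHp] u /= => [/eqP-> | /andP[_ /IHp h]]; first exact: mem_head.
by rewrite inE h orbT.
Qed.

Lemma visits_source u v p x : walk u p v -> x \in p -> source x \in visits u p.
Proof.
elim: p u => [|y p IHp] u //= /andP[/eqP <- yp].
rewrite inE => /orP[/eqP-> | xp]; first exact: mem_head.
by rewrite inE (IHp _ yp xp) orbT.
Qed.

Lemma visits_target u p x : x \in p -> target x \in visits u p.
Proof. by move=> xp; rewrite inE map_f ?orbT. Qed.

Lemma visits_cat u v p q z : walk u p v ->
  z \in visits u (p ++ q) -> z \in visits u p \/ z \in visits v q.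
Proof.
move=> up; rewrite /visits map_cat -cat_cons mem_cat => /orP[]; first by left.
by move=> zq; right; rewrite inE zq orbT.
Qed.

Definition rev_walk p : seq D := rev [seq rev_dart x | x <- p].

Lemma walk_rev u v p : walk u p v -> walk v (rev_walk p) u.
Proof.
elim: p u => [|x p IHp] u /=; first by rewrite eq_sym.
case/andP=> /eqP xu /IHp h; rewrite /rev_walk /= rev_cons -cats1.
by apply: walk_cat h _; rewrite /= /target rev_dart_inv xu !eqxx.
Qed.

Lemma walk_length_rev p : walk_length (rev_walk p) = walk_length p.
Proof.
rewrite /walk_length /rev_walk (perm_big _ (permEl (perm_rev _))) big_map.
by apply: eq_bigr => x _; rewrite weight_rev.
Qed.

Lemma visits_rev u v p : walk u p v -> visits v (rev_walk p) =i visits u p.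
Proof.
have sub a b q : walk a q b -> {subset visits b (rev_walk q) <= visits a q}.
  move=> aq z; rewrite inE => /orP[/eqP->|]; first exact: visits_last aq.
  case/mapP=> y; rewrite mem_rev => /mapP[x xq ->] ->.
  by rewrite /target rev_dart_inv (visits_source aq xq).
move=> up z; apply/idP/idP; first exact: sub.
have {1}<- : rev_walk (rev_walk p) = p.
  rewrite /rev_walk map_rev revK -map_comp -[RHS]map_id.
  by apply: eq_map => x /=; rewrite rev_dart_inv.
exact: sub (walk_rev up) z.
Qed.

(** Each dart contributes its two ends, and the sum telescopes modulo 2. *)
Lemma walk_boundary u v w p : walk u p v ->
  \sum_(x : D | source x == w)
     ((count_mem x p)%:R + (count_mem (rev_dart x) p)%:R) =
  (w == u)%:R + (w == v)%:R :> 'F_2.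
Proof.
have sum1 (y : D) : \sum_(x : D | source x == w) (y == x)%:R = (w == source y)%:R :> 'F_2.
  rewrite [w == _]eq_sym; case: eqP => [yw | nyw].
    rewrite (bigD1 y) /= ?yw ?eqxx // big1 ?addr0 // => x /andP[_].
    by rewrite eq_sym => /negPf->.
  by rewrite big1 // => x /eqP xw; case: eqP => // yx; case: nyw; rewrite yx.
elim: p u => [|y p IHp] u /=.
  by move/eqP->; rewrite !addrrF2 big1.
case/andP=> /eqP <- /IHp IH.
under eq_bigr => x _ do rewrite !natrD addrACA.
rewrite big_split IH /= big_split /= sum1.
under eq_bigr => x _ do rewrite -(inj_eq (can_inj (@rev_dart_inv R G))) rev_dart_inv.
by rewrite sum1 -/(target y) -addrA (addrA (_ == target y)%:R) addrrF2 add0r.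
Qed.

Lemma source_next_on_face (x : D) : source (face x) = target x.
Proof.
by apply/eqP; rewrite /target eq_sym source_next_dart /next_on_face fconnect1.
Qed.

Lemma walk_face (x : D) n : walk (source x) (traject face x n) (source (iter n face x)).
Proof.
elim: n x => [|n IHn] x /=; first by rewrite eqxx.
by rewrite eqxx -source_next_on_face -iterS iterSr IHn.
Qed.

Lemma face_inj : injective face.
Proof. exact: next_on_face_inj (@rev_dart_inv R G) (@next_dart_inj R G). Qed.

(* Closing the walk from [x] to [face^n x] along the face gives a cycle; the  *)
(* set of faces it bounds, corrected on the arc, yields [h], which tells on   *)
(* which side of the walk a dart lies within the complement of the face.      *)
Lemma side_of_walk (x : D) n p :
    (0 < n < order face x)%N -> walk (source x) p (source (iter n face x)) ->
  exists h : D -> 'F_2,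
    [/\ forall y, h y + h (rev_dart y) =
                  (count_mem y p)%:R + (count_mem (rev_dart y) p)%:R,
        forall y, source y \notin visits (source x) p -> h (next_dart y) = h y
      & forall k, (k < order face x)%N -> h (iter k face x) = h x + (n <= k)%:R].
Proof.
case/andP=> n_gt0 ltn xp; pose arc := traject face x n.
have arcE y : (count_mem y arc)%:R = (y \in arc)%:R :> 'F_2.
  rewrite count_uniq_mem //; apply/(uniqP x) => i j.
  rewrite !inE size_traject => lti ltj.
  rewrite !nth_traject // => eij.
  have := findex_iter (ltn_trans lti ltn); rewrite eij findex_iter //.
  exact: ltn_trans ltj ltn.
have mem_arc k : (k < order face x)%N -> (iter k face x \in arc) = (k < n)%N.
  move=> ltk; apply/idP/idP => [/trajectP[j ltj ekj] | kn].
    have := findex_iter ltk; rewrite ekj findex_iter ?(ltn_trans ltj ltn) //.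
    by move=> <-.
  by apply/trajectP; exists k.
pose y0 (z : D) : 'F_2 := (count_mem z p)%:R + (count_mem z arc)%:R.
have [|g g_face gE] := @cycle_bounds D (@rev_dart R G) (@next_dart R G)
    (@rev_dart_inv R G) (@rev_dart_neq R G) (@next_dart_inj R G) (planar G) y0.
  move=> z; rewrite /y0.
  under eq_bigl => a do rewrite -source_next_dart eq_sym.
  under eq_bigr => a _ do rewrite addrACA.
  by rewrite big_split /= (walk_boundary _ xp) (walk_boundary _ (walk_face x n)) addrrF2.
pose h (z : D) := g z + (z \in arc)%:R.
have hE y : h y + h (rev_dart y) = (count_mem y p)%:R + (count_mem (rev_dart y) p)%:R.
  by rewrite /h addrACA gE /y0 !arcE [X in X + _]addrACA -addrA addrrF2 addr0.
exists h; split=> // [y yp | k ltk].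
  rewrite -{1}(rev_dart_inv y) -/(face (rev_dart y)).
  have -> : h y = h (rev_dart y).
    apply: addF2_eq0; rewrite hE !(count_memPn _) ?addr0 //.
      by apply: contra yp => /(visits_target (source x)); rewrite /target rev_dart_inv.
    by apply: contra yp; apply: visits_source xp.
  rewrite /h g_face; congr (_ + (_ : bool)%:R).
  have {yp} : source (face (rev_dart y)) \notin visits (source x) p.
    by rewrite source_next_on_face /target rev_dart_inv.
  (* Moving from [z] to [face z] enters or leaves [arc] only at an end of the arc, and both ends are
     visited by [p]. *)
  move: (rev_dart y) => z zp; apply/idP/idP => /trajectP[k ltk].
    case: k ltk => [|k] ltk /=.
      by move=> E; rewrite E mem_head in zp.
    by move/face_inj->; apply/trajectP; exists k => //; apply: ltnW.
  move=> zE; apply/trajectP; exists k.+1; last by rewrite zE.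
  rewrite ltn_neqAle ltk andbT; apply: contraNneq zp => kn.
  by rewrite zE -iterS kn (visits_last xp).
rewrite /h; have -> : g (iter k face x) = g x by elim: k {ltk} => //= k IHk; rewrite g_face.
have := mem_arc 0%N (leq_ltn_trans (leq0n n) ltn); rewrite /= => ->.
rewrite mem_arc // n_gt0 -addrA; congr (_ + _).
by case: (leqP n k) => _; rewrite ?addrrF2 ?addr0.
Qed.

Definition crossing a b c e : Prop :=
  forall p q, walk a p b -> walk c q e -> exists2 z, z \in visits a p & z \in visits c q.

Lemma crossing_refl a b e : crossing a b a e.
Proof. by move=> p q _ _; exists a; apply: mem_head. Qed.

Lemma crossing_swap a b c e : crossing a b c e -> crossing c e a b.
Proof. by move=> h p q hp hq; have [z z1 z2] := h q p hq hp; exists z. Qed.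

Lemma crossing_revl a b c e : crossing a b c e -> crossing b a c e.
Proof.
move=> h p q hp hq; have [z] := h _ q (walk_rev hp) hq.
by rewrite (visits_rev hp); exists z.
Qed.

Lemma crossing_revr a b c e : crossing a b c e -> crossing a b e c.
Proof. by move/crossing_swap/crossing_revl/crossing_swap. Qed.

(** If the second walk avoided the first, the side function [h] of the first would be constant along
    it. But [h] differs at positions k, inside the arc from i to j, and l, outside it. *)
Lemma face_crossing (x : D) i j k l :
    (i <= k <= j)%N -> (j <= l < order face x)%N ->
  crossing (source (iter i face x)) (source (iter j face x))
           (source (iter k face x)) (source (iter l face x)).
Proof.
case/andP=> ik kj /andP[jl ltl].
have [-> | nik] := eqVneq i k; first exact: crossing_refl.
have [<- | nkj] := eqVneq k j; first exact/crossing_revl/crossing_refl.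
have {}ik : (i < k)%N by rewrite ltn_neqAle nik.
have {}kj : (k < j)%N by rewrite ltn_neqAle nkj.
have iterB m : (i <= m)%N -> iter m face x = iter (m - i) face (iter i face x).
  by move=> im; rewrite -iterD subnK.
(* The face is reread from its i-th dart, so that the arc starts at position 0. *)
rewrite (iterB j) ?(iterB k) ?(iterB l); try lia.
have oE : order face (iter i face x) = order face x.
  apply: eq_card => z; rewrite !inE.
  by rewrite -(same_connect (fconnect_sym face_inj) (fconnect_iter face i x)).
move=> p q; move: (iter i face x) oE => y oE hp hq.
case: (pselect (exists2 z, z \in visits (source y) p
   & z \in visits (source (iter (k - i) face y)) q)) => // no_meet.
have [|h [h_rev h_next h_face]] := @side_of_walk y (j - i) p _ hp; first lia.
have off a : a \in visits (source (iter (k - i) face y)) q -> a \notin visits (source y) p.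
  by move=> aq; apply/negP => ap; case: no_meet; exists a.
have h_off (a b : D) : source a = source b -> source a \notin visits (source y) p -> h a = h b.
  move=> /eqP; rewrite source_next_dart => /iter_findex <- ap.
  elim: (findex _ _ _) => //= m IHm; rewrite h_next //.
  suff /eqP <- : source a == source (iter m (@next_dart R G) a) by [].
  by rewrite source_next_dart fconnect_iter.
have h_walk : forall (a b : D) r, walk (source a) r (source b) ->
    {subset visits (source a) r <= visits (source (iter (k - i) face y)) q} -> h a = h b.
  move=> a b r; elim: r a => [|c r IHr] a /=.
    by move=> /eqP ab sub; apply: h_off => //; apply/off/sub/mem_head.
  case/andP=> /eqP ca cr sub.
  have cp : source a \notin visits (source y) p by apply/off/sub/mem_head.
  have c'p : target c \notin visits (source y) p.
    by apply/off/sub; rewrite inE mem_head orbT.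
  rewrite (h_off a c) // (_ : h c = h (rev_dart c)).
    by apply: IHr => // d dr; apply: sub; rewrite inE dr orbT.
  apply: addF2_eq0; rewrite h_rev !(count_memPn _) ?addr0 //.
    apply: contra cp => /(visits_target (source y)).
    by rewrite /target rev_dart_inv ca.
  by apply: contra cp => /(visits_source hp); rewrite ca.
have := h_walk _ _ _ hq (fun _ => id).
rewrite !h_face ?oE; try lia.
have -> : (j - i <= k - i)%N = false by lia.
have -> : (j - i <= l - i)%N = true by lia.
by move/addrI.
Qed.

(** The form with [minn] and [maxn] absorbs the direction of each walk and the choice of the first
    one, and leaves side conditions that [lia] settles. *)
Lemma crossing_symmetries (S : nat -> V) n :
    (forall i j k l, (i <= k <= j)%N -> (j <= l < n)%N ->
       crossing (S i) (S j) (S k) (S l)) ->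
  forall i j k l, (maxn i j < n)%N -> (maxn k l < n)%N ->
    (minn i j <= minn k l <= maxn i j)%N && (maxn i j <= maxn k l)%N ||
    (minn k l <= minn i j <= maxn k l)%N && (maxn k l <= maxn i j)%N ->
  crossing (S i) (S j) (S k) (S l).
Proof.
move=> X i j k l.
wlog ij : i j / (i <= j)%N.
  move=> wl; have /orP[ij | ji] := leq_total i j; first exact: wl.
  by rewrite minnC maxnC => *; apply/crossing_revl/wl.
wlog kl : k l / (k <= l)%N.
  move=> wl; have /orP[kl | lk] := leq_total k l; first exact: wl.
  by rewrite [minn k l]minnC [maxn k l]maxnC => *; apply/crossing_revr/wl.
move=> jn ln /orP[h | h]; first by apply: X; lia.
by apply/crossing_swap/X; lia.
Qed.

Lemma subseq_nth (T : eqType) (t b : seq T) x0 : subseq t b ->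
  exists2 f : nat -> nat, {homo f : i j / (i <= j)%N}
    & forall i, (i < size t)%N -> (f i < size b)%N /\ nth x0 t i = nth x0 b (f i).
Proof.
elim: b t => [|y b IHb] [|x t] //=; try by exists id.
case: eqP => [-> | _] /IHb[f f_mono fE].
  exists (fun i => if i is k.+1 then (f k).+1 else 0%N).
    by case=> [|i] [|j] //=; rewrite !ltnS => /f_mono.
  by case=> [|i] //= /fE[].
by exists (fun i => (f i).+1) => // i j /f_mono.
Qed.

Lemma facial_walk_nth (b : seq V) x0 : facial_walk b ->
  (forall i j k l, (i <= k <= j)%N -> (j <= l < size b)%N ->
     crossing (nth x0 b i) (nth x0 b j) (nth x0 b k) (nth x0 b l)) /\
  (forall i j, (i <= j < size b)%N -> exists p, walk (nth x0 b i) p (nth x0 b j)).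
Proof.
case=> [[x ->] | [v [_ ->]]]; last first.
  split=> [i j k l ikj jl | i j /= ij].
    have [-> ->] : i = 0%N /\ k = 0%N by move: ikj jl => /=; lia.
    exact: crossing_refl.
  have [-> ->] : i = 0%N /\ j = 0%N by lia.
  by exists [::]; rewrite /= eqxx.
have nthE i : (i < order face x)%N ->
    nth x0 [seq source y | y <- orbit face x] i = source (iter i face x).
  by move=> lti; rewrite (nth_map x) ?size_orbit // nth_traject.
rewrite size_map size_orbit; split=> [i j k l ikj jl | i j ij].
  by rewrite !nthE; try lia; apply: face_crossing.
rewrite !nthE; try lia.
exists (traject face (iter i face x) (j - i)).
have -> : iter j face x = iter (j - i) face (iter i face x).
  by rewrite -iterD subnK //; lia.
exact: walk_face.
Qed.

Lemma cyclic_on_face_crossing (s : seq V) x0 : cyclic_on_face s ->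
  forall i j k l, (i <= k <= j)%N -> (j <= l < size s)%N ->
     crossing (nth x0 s i) (nth x0 s j) (nth x0 s k) (nth x0 s l).
Proof.
case=> b [/(facial_walk_nth x0)[b_cross _] sub].
have sub_cross (t : seq V) : subseq t b -> forall i j k l,
    (i <= k <= j)%N -> (j <= l < size t)%N ->
    crossing (nth x0 t i) (nth x0 t j) (nth x0 t k) (nth x0 t l).
  move=> /(subseq_nth x0)[f f_mono fE] i j k l /andP[ik kj] /andP[jl ls].
  have [lti ltj ltk] : [/\ i < size t, j < size t & k < size t]%N by split; lia.
  rewrite (fE i lti).2 (fE j ltj).2 (fE k ltk).2 (fE l ls).2.
  by apply: b_cross; rewrite !f_mono // (fE l ls).1.
case: sub => [/sub_cross // | sub i j k l ikj jl].
have {}sub : subseq (rev s) b by rewrite -subseq_rev revK.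
have nthE m : (m < size s)%N -> nth x0 s m = nth x0 (rev s) (size s - m.+1).
  by move=> ms; rewrite nth_rev; [congr nth; lia | lia].
rewrite !nthE; try lia.
(* Reversal turns the order i, k, j, l into l, j, k, i: the two walks exchange roles and
   directions. *)
by apply/crossing_swap/crossing_revl/crossing_revr/(sub_cross _ sub); rewrite ?size_rev; lia.
Qed.

Lemma cyclic_on_face_walk (s : seq V) x0 i j : cyclic_on_face s ->
  (i < size s)%N -> (j < size s)%N -> exists p, walk (nth x0 s i) p (nth x0 s j).
Proof.
case=> b [/(facial_walk_nth x0)[_ b_walk] sub].
have s_b z : z \in s -> z \in b.
  by case: sub => /mem_subseq h /h; rewrite ?mem_rev.
move=> /(mem_nth x0)/s_b/(nthP x0)[k kb <-] /(mem_nth x0)/s_b/(nthP x0)[l lb <-].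
have [kl | lk] := leqP k l; first by apply: b_walk; rewrite kl.
have [|p /walk_rev hp] := b_walk l k; first by rewrite ltnW.
by exists (rev_walk p).
Qed.

(** * Geodesics and exchange of their tails *)

Definition shortest u p v : Prop :=
  walk u p v /\ forall q, walk u q v -> walk_length p <= walk_length q.

(** Weights have a positive minimum, so walks with many darts are longer than [p0], and only
    finitely many candidates remain. *)
Lemma shortest_walk u v p0 : walk u p0 v -> exists p, shortest u p v.
Proof.
(* A nonempty walk supplies the dart needed to take a minimum of the weights; the empty walk is
   already shortest. *)
case: p0 => [|x0 p0'] up0.
  by exists [::]; split=> // q _; rewrite /walk_length big_nil walk_length_ge0.
move: (x0 :: p0') up0 => p0 up0.
have [x _ x_min] := @Order.TotalTheory.arg_minP _ _ D x0 xpredT (@weight R G) isT.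
set m := weight x in x_min; have m_gt0 : 0 < m := weight_gt0 x.
pose N := Num.bound (walk_length p0 / m).
have lenN q : (N <= size q)%N -> walk_length p0 < walk_length q.
  move=> Nq; have /archi_boundP : 0 <= walk_length p0 / m.
    by rewrite divr_ge0 ?walk_length_ge0 // ltW.
  rewrite -/N ltr_pdivrMr // => /lt_le_trans; apply.
  apply: (@le_trans _ _ ((size q)%:R * m)); first by rewrite ler_pM2r ?ler_nat.
  rewrite /walk_length mulr_natl -sum1_size -sumrMnr.
  by apply: ler_sum => y _; rewrite mulr1n x_min.
have p0N : (size p0 <= N)%N.
  by rewrite leqNgt; apply/negP => /ltnW/lenN; rewrite ltxx.
have [p up p_min] := @Order.TotalTheory.arg_minP _ _ _ (Bseq p0N)
  (fun p : N.-bseq D => walk u p v) (fun p : N.-bseq D => walk_length p) up0.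
exists p; split=> // q uq; have [Nq | qN] := ltnP N (size q).
  apply: le_trans (p_min (Bseq p0N) up0) _; exact/ltW/lenN/ltnW.
exact: (p_min (Bseq qN)).
Qed.

Lemma wdist_le u v p : walk u p v -> (wdist u v <= (walk_length p)%:E)%E.
Proof. by move=> up; apply: ereal_inf_lbound; exists p. Qed.

Lemma wdist_shortest u v p : shortest u p v -> wdist u v = (walk_length p)%:E.
Proof.
case=> up p_min; apply/eqP; rewrite eq_le wdist_le //=.
by apply: le_ereal_inf_tmp => _ [q uq <-]; rewrite lee_fin p_min.
Qed.

Lemma wdist_walk u v : (wdist u v < +oo)%E -> exists p, walk u p v.
Proof.
move=> uv; apply: contrapT => no_walk.
suff uv_oo : wdist u v = +oo%E by rewrite uv_oo ltxx in uv.
by apply/ereal_inf_pinfty => _ [p up <-]; case: no_walk; exists p.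
Qed.

Definition on_geodesic u a z : Prop :=
  exists p q, [/\ walk u p z, walk z q a & shortest u (p ++ q) a].

Definition between u m z a : Prop :=
  exists r p q, [/\ walk u r m, walk m p z, walk z q a & shortest u (r ++ p ++ q) a].

Lemma between_on u m z a : between u m z a -> on_geodesic u a z.
Proof.
case=> r [p [q [ur mp zq short]]]; exists (r ++ p), q.
by rewrite -catA; split=> //; apply: walk_cat mp.
Qed.

(** The part up to [z] of the geodesic to [a], which passes through [m], is itself shortest, so it
    can replace the part up to [z] of the geodesic to [b]. *)
Lemma between_transfer u m z a b :
  between u m z a -> on_geodesic u b z -> on_geodesic u b m.
Proof.
case=> r [p [q [ur mp zq [_ min_a]]]] [r' [q' [ur' zq' [_ min_b]]]].
exists r, (p ++ q'); split=> //; first exact: walk_cat zq'.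
split=> [|w uw]; first exact/(walk_cat ur)/(walk_cat mp).
have := min_a _ (walk_cat ur' zq); have := min_b _ uw.
rewrite !walk_length_cat; lra.
Qed.

Lemma geodesic_tail u a m : on_geodesic u a m ->
  exists2 p, walk m p a & forall z, z \in visits m p -> between u m z a.
Proof.
case=> r [p [ur mp short]]; exists p => // z zp.
have [p1 [p2 [pE mp1 zp2]]] := walk_split mp zp.
by exists r, p1, p2; rewrite -pE.
Qed.

Lemma on_geodesic_start u a p : walk u p a -> on_geodesic u a u.
Proof.
move/shortest_walk=> [q short]; exists [::], q; split=> //=.
by case: short.
Qed.

(** The walk goes back from [a] to [m] and on to [b]. That its vertices lie beyond [m] is what
    [between_transfer] requires. *)
Lemma chord v u a b m : on_geodesic v a m -> on_geodesic u b m ->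
  exists2 p, walk a p b
    & forall z, z \in visits a p -> between v m z a \/ between u m z b.
Proof.
move=> /geodesic_tail[p mp hp] /geodesic_tail[q mq hq].
exists (rev_walk p ++ q); first exact: walk_cat (walk_rev mp) mq.
move=> z /(visits_cat (walk_rev mp)); rewrite (visits_rev mp).
by case=> [/hp | /hq]; [left | right].
Qed.

Definition meet v a u b : Prop := exists2 z, on_geodesic v a z & on_geodesic u b z.

Lemma meet_sym v a u b : meet v a u b -> meet u b v a.
Proof. by case=> z; exists z. Qed.

Section Meet.
Variables (u v a b c e : V).

(** The walks a-v-c and b-u-e, made of geodesics, meet; two of the four possible kinds of meeting
    are excluded. *)
Lemma meet_of_crossing :
    on_geodesic v a v -> on_geodesic v c v -> on_geodesic u b u -> on_geodesic u e u ->
    crossing a c b e -> ~ meet v a u b -> ~ meet v c u e ->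
  meet v a u e \/ meet v c u b.
Proof.
move=> va vc ub ue X nab nce.
have [p ap hp] := chord va vc; have [q bq hq] := chord ub ue.
have [z /hp zp /hq zq] := X _ _ ap bq.
case: zp zq => /between_on zp [] /between_on zq.
- by case: nab; exists z.
- by left; exists z.
- by right; exists z.
- by case: nce; exists z.
Qed.

(** The walk from [a] to [b] through the meeting vertex [m] hits c-u-e at some [z]. On the side of
    [a], [z] is the required meeting vertex; on the side of [b], exchange at [z] moves it back to
    [m]. *)
Lemma meet_forced :
    on_geodesic u c u -> on_geodesic u e u -> meet v a u b ->
    crossing a b c e -> ~ meet v a u c -> meet v a u e.
Proof.
move=> uc ue [m vm um] X nac.
have [p ap hp] := chord vm um; have [q cq hq] := chord uc ue.
have [z /hp zp /hq zq] := X _ _ ap cq.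
case: zp zq => zp [] /between_on zq.
- by case: nac; exists z => //; apply: between_on zp.
- by exists z => //; apply: between_on zp.
- by case: nac; exists m => //; apply: between_transfer zp zq.
- by exists m => //; apply: between_transfer zp zq.
Qed.

(** The walks a-m-b and c-m'-e share a vertex [z]; [z] or, after exchange, [m] witnesses one of the
    two excluded meetings. *)
Lemma meet_exclusive : meet v a u b -> meet v c u e -> crossing a b c e ->
  ~ meet v a u e -> ~ meet v c u b -> False.
Proof.
move=> [m vm um] [m' vm' um'] X nae ncb.
have [p ap hp] := chord vm um; have [q cq hq] := chord vm' um'.
have [z /hp zp /hq zq] := X _ _ ap cq.
case: zp zq => zp [] zq.
- by apply: ncb; exists m => //; apply: between_transfer zp (between_on zq).
- by apply: nae; exists z; [apply: between_on zp | apply: between_on zq].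
- by apply: ncb; exists z; [apply: between_on zq | apply: between_on zp].
- by apply: nae; exists m => //; apply: between_transfer zp (between_on zq).
Qed.

End Meet.

(** * Halfspaces and shattered sets of pairs *)

(** In [halfspace] the default of [nth] is the tested vertex; a common default lets two vertices
    refer to the same terminals. *)
Lemma halfspaceE (s : seq V) x0 i (x : R) v : (i.+1 < size s)%N ->
  halfspace s i x v <-> (wdist v (nth x0 s i) <= wdist v (nth x0 s i.+1) + x%:E)%E.
Proof.
by move=> lti; rewrite /halfspace /= !(set_nth_default x0 v) // ltnW.
Qed.

(* Rerouting two intersecting geodesics at a common vertex exchanges their    *)
(* ends without lengthening them.                                             *)
Lemma halfspace_not_meet (s : seq V) x0 i (x : R) v u : (i.+1 < size s)%N ->
    halfspace s i x v -> ~ halfspace s i x u ->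
  ~ meet v (nth x0 s i) u (nth x0 s i.+1).
Proof.
move=> lti /(halfspaceE x0 _ _ lti) Hv Hu [z [p1 [p2 [vp1 zp2 min_p]]]].
case=> q1 [q2 [uq1 zq2 min_q]]; apply: Hu; apply/(halfspaceE x0 _ _ lti).
move: Hv; rewrite (wdist_shortest min_p) (wdist_shortest min_q) => Hv.
have := le_trans Hv (leeD2r x%:E (wdist_le (walk_cat vp1 zq2))).
move=> le_p; apply: le_trans (wdist_le (walk_cat uq1 zp2)) _.
move: le_p; rewrite -!EFinD !lee_fin !walk_length_cat; lra.
Qed.

(** An infinite right-hand side would satisfy the inequality. *)
Lemma not_halfspace_walk (s : seq V) x0 i (x : R) v : (i.+1 < size s)%N ->
  ~ halfspace s i x v -> exists p, walk v p (nth x0 s i.+1).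
Proof.
move=> lti Hv; apply: wdist_walk; rewrite ltey; apply/eqP => v_oo.
by apply: Hv; apply/(halfspaceE x0 _ _ lti); rewrite v_oo addye // leey.
Qed.

Lemma halfspace_alternation (s : seq V) (x : nat -> R) i1 i2 i3 i4 u v :
    cyclic_on_face s -> (i1 < i2 < i3)%N -> (i3 < i4)%N -> (i4.+1 < size s)%N ->
    halfspace s i1 (x i1) v -> ~ halfspace s i2 (x i2) v ->
    halfspace s i3 (x i3) v -> ~ halfspace s i4 (x i4) v ->
    ~ halfspace s i1 (x i1) u -> halfspace s i2 (x i2) u ->
    ~ halfspace s i3 (x i3) u -> halfspace s i4 (x i4) u ->
  False.
Proof.
move=> cyc /andP[i12 i23] i34 i4s v1 v2 v3 v4 u1 u2 u3 u4.
pose S i := nth v s i.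
have X i j k l := @crossing_symmetries S (size s) (@cyclic_on_face_crossing s v cyc) i j k l.
(* A vertex outside some halfspace reaches one terminal, hence all of them along the face, so its
   geodesics exist. *)
have start w i : (i < size s)%N -> ~ halfspace s i4 (x i4) w \/ ~ halfspace s i3 (x i3) w ->
    on_geodesic w (S i) w.
  move=> ltis w34; have [j js [p wp]] : exists2 j, (j < size s)%N & exists p, walk w p (S j).
    case: w34 => H.
      by exists i4.+1 => //; apply: not_halfspace_walk H.
    by exists i3.+1; [lia | apply: not_halfspace_walk H; lia].
  have [q jq] := @cyclic_on_face_walk s v j i cyc js ltis.
  exact: on_geodesic_start (walk_cat wp jq).
have vS i : (i < size s)%N -> on_geodesic v (S i) v by move=> *; apply: start => //; left.
have uS i : (i < size s)%N -> on_geodesic u (S i) u by move=> *; apply: start => //; right.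
have n1 : ~ meet v (S i1) u (S i1.+1) by apply: halfspace_not_meet v1 u1; lia.
have n2 : ~ meet v (S i2.+1) u (S i2).
  by move/meet_sym; apply: halfspace_not_meet u2 v2; lia.
have n3 : ~ meet v (S i3) u (S i3.+1) by apply: halfspace_not_meet v3 u3; lia.
have n4 : ~ meet v (S i4.+1) u (S i4).
  by move/meet_sym; apply: halfspace_not_meet u4 v4; lia.
have m13 : meet v (S i1) u (S i3.+1) \/ meet v (S i3) u (S i1.+1).
  by apply: meet_of_crossing n1 n3; try (apply: vS || apply: uS || apply: X); lia.
have m24 : meet v (S i2.+1) u (S i4) \/ meet v (S i4.+1) u (S i2).
  by apply: meet_of_crossing n2 n4; try (apply: vS || apply: uS || apply: X); lia.
have forced_u i k j l : (maxn i k < size s)%N -> (maxn j l < size s)%N ->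
    (minn i k <= minn j l <= maxn i k)%N && (maxn i k <= maxn j l)%N ||
    (minn j l <= minn i k <= maxn j l)%N && (maxn j l <= maxn i k)%N ->
    meet v (S i) u (S k) -> ~ meet v (S i) u (S j) -> meet v (S i) u (S l).
  by move=> *; apply: (meet_forced (b := S k) (c := S j)) => //; [apply: uS | apply: uS | apply: X]; lia.
have forced_v i k j l : (maxn i k < size s)%N -> (maxn j l < size s)%N ->
    (minn i k <= minn j l <= maxn i k)%N && (maxn i k <= maxn j l)%N ||
    (minn j l <= minn i k <= maxn j l)%N && (maxn j l <= maxn i k)%N ->
    meet v (S i) u (S k) -> ~ meet v (S j) u (S k) -> meet v (S l) u (S k).
  move=> *; apply/meet_sym; apply: (meet_forced (b := S i) (c := S j)).
  - by apply: vS; lia.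
  - by apply: vS; lia.
  - exact: meet_sym.
  - by apply/crossing_revl/X; lia.
  - exact: contra_not (@meet_sym _ _ _ _) _.
have excl i k j l : (maxn i k < size s)%N -> (maxn j l < size s)%N ->
    (minn i k <= minn j l <= maxn i k)%N && (maxn i k <= maxn j l)%N ||
    (minn j l <= minn i k <= maxn j l)%N && (maxn j l <= maxn i k)%N ->
    ~ meet v (S i) u (S l) -> ~ meet v (S j) u (S k) ->
    meet v (S i) u (S k) -> meet v (S j) u (S l) -> False.
  by move=> h1 h2 h3 nil njk mik mjl; apply: meet_exclusive mik mjl _ nil njk; apply: X.
(* The four cases end in the opposite pairs 34, 14, 23 and 12, in this order. *)
case: m13 => [m13 | m31]; case: m24 => [m24 | m42].
- apply: (excl i4.+1 i3.+1 i3 i4) => //; try lia.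
    by apply: (forced_v i1 i3.+1 i3 i4.+1) => //; lia.
  by apply: (forced_v i2.+1 i4 i4.+1 i3) => //; lia.
- apply: (excl i1 i4 i4.+1 i1.+1) => //; try lia.
    by apply: (forced_u i1 i3.+1 i1.+1 i4) => //; lia.
  by apply: (forced_u i4.+1 i2 i4 i1.+1) => //; lia.
- apply: (excl i3 i2 i2.+1 i3.+1) => //; try lia.
    by apply: (forced_u i3 i1.+1 i3.+1 i2) => //; lia.
  by apply: (forced_u i2.+1 i4 i2 i3.+1) => //; lia.
- apply: (excl i2.+1 i1.+1 i1 i2) => //; try lia.
    by apply: (forced_v i3 i1.+1 i1 i2.+1) => //; lia.
  by apply: (forced_v i4.+1 i2 i2.+1 i1) => //; lia.
Qed.

Lemma halfspace_mono (s : seq V) i (x y : R) v :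
  x <= y -> halfspace s i x v -> halfspace s i y v.
Proof.
by move=> xy /le_trans; apply; rewrite leeD2l // lee_fin.
Qed.

Lemma shattered_trace_card (s : seq V) (d delta : R) (Y : set (nat * R)) :
    cyclic_on_face s -> Y `<=` pair_universe s d delta ->
  shattered (trace_family s d delta) Y -> (Y #<= `I_3)%card.
Proof.
move=> cyc YX shat.
have trace (P : nat * R -> Prop) : exists v, forall a, Y a ->
    trace_set s d delta v a <-> P a.
  have [_ [v _ <-] YvE] := shat (Y `&` P) (@subIsetl _ _ _).
  exists v => a Ya; have -> : trace_set s d delta v a <-> (Y `&` trace_set s d delta v) a.
    by split=> [|[]].
  by rewrite YvE; split=> [[]|].
(* Shattering puts every element of [Y] into some trace, and no trace contains the last index. *)
have Y_lt a : Y a -> (a.1.+1 < size s)%N.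
  by move=> Ya; have [v /(_ a Ya)[_ /(_ I)[+ _ _]]] := trace (fun=> True); lia.
have traceE v a : Y a -> trace_set s d delta v a <-> halfspace s a.1 a.2 v.
  move=> Ya; have [_ off_a] := YX a Ya; have lta := Y_lt a Ya.
  by split=> [[] | ?] //; split=> //; lia.
have half (P : nat * R -> Prop) : exists v, forall a, Y a -> halfspace s a.1 a.2 v <-> P a.
  by have [v vP] := trace P; exists v => a Ya; rewrite -traceE // vP.
have fst_inj : {in Y &, injective (@fst nat R)}.
  move=> a b; rewrite !inE => Ya Yb eab.
  wlog ab : a b Ya Yb eab / a.2 <= b.2.
    by move=> wl; case/orP: (le_total a.2 b.2) => ?; [|symmetry]; apply: wl.
  (* The trace of [v] on [Y] is the singleton of [a], yet by nesting it contains [b]. *)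
  have [v vP] := half (eq a).
  have /(halfspace_mono ab) : halfspace s a.1 a.2 v by apply/vP.
  by rewrite eab => /vP; apply.
rewrite -(card_le_eql (inj_card_eq fst_inj)).
set I := fst @` Y; pose t := [seq i <- iota 0 (size s) | `[< I i >]].
have mem_t i : i \in t -> I i by rewrite mem_filter => /andP[/asboolP].
have I_t i : I i -> i \in t.
  move=> Ii; rewrite mem_filter mem_iota add0n; apply/andP; split; first exact/asboolP.
  by have [a Ya <-] := Ii; have := Y_lt a Ya; lia.
have t_sorted : sorted ltn t by apply: sorted_filter ltn_trans _ _ _; apply: iota_ltn_sorted.
have [t3 | t4] := leqP (size t) 3.
  apply: (@card_le_trans _ _ _ `I_(size t)); last by rewrite card_le_II.
  apply: card_le_trans (card_image_le (nth 0%N t) _); apply: subset_card_le.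
  by move=> i /I_t /(nthP 0%N)[j jt <-]; exists j.
have [|x xP] := @choice nat R (fun i r => I i -> Y (i, r)).
  move=> i; have [[a Ya <-] | nI] := pselect (I i); last by exists 0 => /nI.
  by exists a.2 => _; case: a Ya.
pose n k := nth 0%N t k.
have n_lt k l : (k < l < size t)%N -> (n k < n l)%N.
  by move=> kl; apply: (sorted_ltn_nth ltn_trans 0%N t_sorted); rewrite ?inE; lia.
have Yn k : (k < size t)%N -> Y (n k, x (n k)) by move=> kt; apply/xP/mem_t/mem_nth.
have [v vP] := half (fun a => a.1 = n 0%N \/ a.1 = n 2%N).
have [u uP] := half (fun a => a.1 = n 1%N \/ a.1 = n 3%N).
have n01 : (n 0 < n 1)%N by apply: n_lt; lia.
have n12 : (n 1 < n 2)%N by apply: n_lt; lia.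
have n23 : (n 2 < n 3)%N by apply: n_lt; lia.
have [Y0 Y1 Y2 Y3] : [/\ Y (n 0%N, x (n 0%N)), Y (n 1%N, x (n 1%N)),
    Y (n 2%N, x (n 2%N)) & Y (n 3%N, x (n 3%N))] by split; apply: Yn; lia.
exfalso; apply: (@halfspace_alternation s x (n 0) (n 1) (n 2) (n 3) u v cyc)%N.
- by rewrite n01.
- by [].
- exact: Y_lt Y3.
- by apply/(vP _ Y0); left.
- by move/(vP _ Y1) => /=; lia.
- by apply/(vP _ Y2); right.
- by move/(vP _ Y3) => /=; lia.
- by move/(uP _ Y0) => /=; lia.
- by apply/(uP _ Y1); left.
- by move/(uP _ Y2) => /=; lia.
- by apply/(uP _ Y3); right.
Qed.

End Walks.

(** A nonempty family shatters the empty set, so a largest shattered size exists below the bound. *)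
Lemma VC_dim_exists (T : Type) (X : set T) (F : set (set T)) (n : nat) :
    F !=set0 -> (forall Y, Y `<=` X -> shattered F Y -> (Y #<= `I_n)%card) ->
  exists2 k : nat, has_VC_dim X F k & (k <= n)%N.
Proof.
move=> [A FA] bound.
pose P k := `[< exists Y, [/\ Y `<=` X, shattered F Y & (Y #= `I_k)%card] >].
have P0 : exists k, P k.
  exists 0%N; apply/asboolP; exists set0; split; first exact: sub0set.
    by move=> Y'; rewrite subset0 => ->; exists A; rewrite ?set0I.
  by rewrite II0 card_eq00.
have P_le k : P k -> (k <= n)%N.
  move=> /asboolP[Y [YX shat Yk]].
  by rewrite -card_le_II -(card_le_eql Yk) bound.
have [k /asboolP Pk k_max] := ex_maxnP P0 P_le.
exists k; last exact/P_le/asboolP.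
split=> // Y YX shat.
have /finite_setP[m Ym] : finite_set Y by apply/finite_set_leP; exists n; apply: bound.
rewrite (card_le_eql Ym) card_le_II; apply: k_max; apply/asboolP.
by exists Y.
Qed.

Theorem theorem3p16 (R : realType) (G : weighted_plane_graph R) (d delta : R)
    (l : nat) (s : l.-tuple (vertex G)) :
  0 < d -> 0 < delta -> (0 < l)%N -> cyclic_on_face s ->
  exists2 k : nat,
    has_VC_dim (pair_universe s d delta) (trace_family s d delta) k & (k <= 3)%N.
Proof.
move=> _ _ l_gt0 cyc; apply: VC_dim_exists => [|Y]; last exact: shattered_trace_card.
by exists (trace_set s d delta (tnth s (Ordinal l_gt0))), (tnth s (Ordinal l_gt0)).
Qed.
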